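(* Let $R$ be a ring, let $\{N_1,\dots,N_k\}$ be a collection of ideals of $R$ satisfying the CNC-condition, and let $s_i$ be the characteristic of $N_i$ in $N_{i+1}$ ($i=1,\dots,k-1$). Then: (1) If $w$ is a natural number with $(x+N_1)^w=1+N_1$ for all $x+N_1\in (R/N_1)^*$, then $x^{w s_1\cdots s_{k-1}}=1$ for all $x\in R^*$. (2) If $(R/N_1)^*$ is finite, then $x^{|(R/N_1)^*|\, s_1\cdots s_{k-1}}=1$ for all $x\in R^*$. (3) If $R^*$ is finite, then $x^{|(R/N_1)^*|\,|N_1|}=1$ for all $x\in R^*$.
   Context: Rings are associative with identity, not necessarily commutative; $S^*$ denotes the group of units of a ring $S$. A collection $\{N_1,\dots,N_k\}$ of ideals of $R$ satisfies the CNC-condition if: (i) $\{0\}=N_k\subset N_{k-1}\subset\cdots\subset N_1\subset R$; (ii) for each $i=1,\dots,k-1$ there is $t_i\ge 2$ with $N_i^{t_i}\subset N_{i+1}$ (the minimal such $t_i$ is the nilpotency index of $N_i$ in $N_{i+1}$); (iii) for each $i=1,\dots,k-1$ there is $s_i\ge 1$ with $s_iN_i\subset N_{i+1}$ and all prime factors of $s_i$ are $\ge t_i$; the minimal such $s_i$ is called the characteristic of $N_i$ in $N_{i+1}$. *)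

(* Defs.v *)
From HB Require Import structures.
From mathcomp Require Import all_boot all_algebra finmap.
From mathcomp Require Import boolp classical_sets cardinality.

Set Implicit Arguments.
Unset Strict Implicit.
Unset Printing Implicit Defensive.

Import GRing.Theory.
Local Open Scope classical_set_scope.
Local Open Scope ring_scope.
Local Open Scope quotient_scope.

(* [pzRingType] is the class of associative rings with identity, neither
   commutative nor nonzero in general; unlike [unitRingType] it carries no unit
   predicate. *)
Definition units (S : pzRingType) : set S :=
  [set x | exists y : S, x * y = 1 /\ y * x = 1].

Arguments units : clear implicits.

(* Meaningful for finite sets only: the value is 0 on infinite ones. *)
Definition set_card (T : choiceType) (A : set T) : nat := #|` fset_set A |.

Record ideal (R : pzRingType) := Ideal {
  ideal_set :> set R;
  ideal0 : ideal_set 0;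
  idealB : forall x y, ideal_set x -> ideal_set y -> ideal_set (x - y);
  idealMl : forall a x, ideal_set x -> ideal_set (a * x);
  idealMr : forall a x, ideal_set x -> ideal_set (x * a) }.

(* The library has the quotient of an additive group by a subgroup, but a ring
   structure on it only for commutative rings; the instances below supply the
   noncommutative, possibly trivial, case. *)
Section Quotient.
Variables (R : pzRingType) (I : ideal R).

Definition ideal_pred : {pred R} := fun x => `[< ideal_set I x >].

Fact ideal_zmod_closed : zmod_closed ideal_pred.
Proof.
split=> [|x y /asboolP Ix /asboolP Iy]; apply/asboolP; first exact: ideal0.
exact: idealB.
Qed.

HB.instance Definition _ := GRing.isZmodClosed.Build R ideal_pred
  ideal_zmod_closed.

Definition quot_ring := Quotient.quot ideal_pred.

HB.instance Definition _ := GRing.Zmodule.on quot_ring.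

Definition residue (x : R) : quot_ring := \pi_(Quotient.quot ideal_pred) x.

Lemma residue_eq (x y : R) : residue x = residue y <-> ideal_set I (x - y).
Proof.
split=> [xy|Ixy].
  by apply/asboolP; move/eqP: xy; rewrite /residue piE Quotient.equivE.
by apply/eqP; rewrite /residue piE Quotient.equivE; apply/asboolP.
Qed.

Lemma residue_surj (u : quot_ring) : exists x, residue x = u.
Proof. by exists (repr u); exact: reprK. Qed.

Definition quot_ring_mul (u v : quot_ring) : quot_ring :=
  residue (repr u * repr v).

Lemma residue_mul (x y : R) :
  quot_ring_mul (residue x) (residue y) = residue (x * y).
Proof.
apply/residue_eq; set x' := repr _; set y' := repr _.
have Ix : ideal_set I (x' - x) by apply/residue_eq; exact: reprK.
have Iy : ideal_set I (y' - y) by apply/residue_eq; exact: reprK.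
have -> : x' * y' - x * y = (x' - x) * y' - x * (y - y').
  by rewrite mulrBl mulrBr opprB addrA addrNK.
by apply: idealB; [exact: idealMr | apply: idealMl; rewrite -opprB -sub0r;
  apply: idealB => //; exact: ideal0].
Qed.

Lemma residue_add (x y : R) : residue x + residue y = residue (x + y).
Proof. by apply/esym; exact: (Quotient.pi_add ideal_pred). Qed.

Fact quot_ring_mulA : associative quot_ring_mul.
Proof.
move=> u v w; have [x <-] := residue_surj u; have [y <-] := residue_surj v.
by have [z <-] := residue_surj w; rewrite !residue_mul mulrA.
Qed.

Fact quot_ring_mul1l : left_id (residue 1) quot_ring_mul.
Proof.
by move=> u; have [x <-] := residue_surj u; rewrite residue_mul mul1r.
Qed.

Fact quot_ring_mul1r : right_id (residue 1) quot_ring_mul.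
Proof.
by move=> u; have [x <-] := residue_surj u; rewrite residue_mul mulr1.
Qed.

Fact quot_ring_mulDl : left_distributive quot_ring_mul +%R.
Proof.
move=> u v w; have [x <-] := residue_surj u; have [y <-] := residue_surj v.
by have [z <-] := residue_surj w; rewrite !(residue_mul, residue_add) mulrDl.
Qed.

Fact quot_ring_mulDr : right_distributive quot_ring_mul +%R.
Proof.
move=> u v w; have [x <-] := residue_surj u; have [y <-] := residue_surj v.
by have [z <-] := residue_surj w; rewrite !(residue_mul, residue_add) mulrDr.
Qed.

HB.instance Definition _ := GRing.Zmodule_isPzRing.Build quot_ring
  quot_ring_mulA quot_ring_mul1l quot_ring_mul1r
  quot_ring_mulDl quot_ring_mulDr.

Fact residue_is_zmod_morphism : zmod_morphism residue.
Proof.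
move=> x y; apply: (addIr (residue y)); rewrite addrNK.
by rewrite residue_add addrNK.
Qed.

HB.instance Definition _ := GRing.isZmodMorphism.Build R quot_ring residue
  residue_is_zmod_morphism.

Fact residue_is_monoid_morphism : monoid_morphism residue.
Proof. by split=> // x y; rewrite -residue_mul. Qed.

HB.instance Definition _ := GRing.isMonoidMorphism.Build R quot_ring residue
  residue_is_monoid_morphism.

End Quotient.

Section Chains.
Variable R : pzRingType.
Implicit Types (I J : set R) (s t : nat).

Definition ideal_prod I J : set R :=
  [set x | exists r : seq (R * R),
     (forall p, p \in r -> I p.1 /\ J p.2) /\ x = \sum_(p <- r) p.1 * p.2].

(* [ideal_pow I 0] is the whole ring, hence [ideal_pow I 1 = I] for an ideal I. *)
Definition ideal_pow I (n : nat) : set R := iter n (ideal_prod I) setT.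

Definition least (P : nat -> Prop) (n : nat) : Prop :=
  P n /\ forall m, P m -> (n <= m)%N.

Definition nilpotent_bound I J t : Prop := (2 <= t)%N /\ ideal_pow I t `<=` J.

Definition nilpotency_index_in I J t : Prop := least (nilpotent_bound I J) t.

Definition char_bound I J t s : Prop :=
  [/\ (1 <= s)%N,
      [set x *+ s | x in I] `<=` J
    & forall p, prime p -> (p %| s)%N -> (t <= p)%N].

(* The value does not depend on the choice of an admissible t: the s >= 1 with
   s I included in J are the multiples of the least one, so its prime factors
   are among those of any other. *)
Definition characteristic_in I J s : Prop :=
  exists t, nilpotency_index_in I J t /\ least (char_bound I J t) s.

(* The collection {N_1, ..., N_k} is given by the values of [N] at 1, ..., k. *)
Definition CNC (k : nat) (N : nat -> ideal R) : Prop :=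
  [/\ (1 <= k)%N,
      N k = [set 0] :> set R,
      forall i, (1 <= i < k)%N -> N i.+1 `<=` N i
    & forall i, (1 <= i < k)%N ->
        exists t, nilpotent_bound (N i) (N i.+1) t /\
          exists s, char_bound (N i) (N i.+1) t s].

End Chains.

(* Main.v *)
Require Import Defs.
From mathcomp Require Import all_boot all_algebra finmap.
From mathcomp Require Import boolp classical_sets cardinality.

(** If [n] lies in [N i], then [(1 + n) ^ s_i] lies in [1 + N i.+1]: in the
    binomial expansion the powers [n ^ j] with [j >= t_i] lie in [N i.+1], and
    for [0 < j < t_i] the index [j] is coprime to [s_i], so that [s_i] divides
    the binomial coefficient.  Hence the exponent [s_1 ... s_(k-1)] kills
    [1 + N 1], which contains the [w]-th power of every unit.  Since [N 1] is
    nil, [1 + N 1] is a group of units, of order [|N 1|], and units of the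
    quotient by [N 1] lift to units; the finite cases then follow from
    Lagrange's theorem. *)

Set Implicit Arguments.
Unset Strict Implicit.
Unset Printing Implicit Defensive.

Import GRing.Theory.
Local Open Scope classical_set_scope.
Local Open Scope ring_scope.

(** * Divisibility of binomial coefficients *)

Lemma dvdn_bin_of_coprime (s j : nat) :
  (0 < j)%N -> coprime s j -> (s %| 'C(s, j))%N.
Proof.
(* Absorption, [j * 'C(s, j) = s * 'C(s.-1, j.-1)], followed by Gauss's lemma. *)
case: j => // j _ sj; rewrite -(Gauss_dvdr _ sj) -mul_bin_diag.
exact: dvdn_mulr.
Qed.

(** A common prime factor of [s] and [j] would be at least [t], yet at most [j]. *)
Lemma coprime_lt_prime_factors (s t j : nat) :
  (forall p, prime p -> (p %| s)%N -> (t <= p)%N) ->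
  (0 < j < t)%N -> coprime s j.
Proof.
move=> ps /andP[j_gt0 jt]; apply/eqP; apply: contraTeq jt => g1.
have pg : prime (pdiv (gcdn s j)).
  by rewrite pdiv_prime // ltn_neqAle eq_sym g1 gcdn_gt0 j_gt0 orbT.
have /andP[gs gj] : (pdiv (gcdn s j) %| s)%N && (pdiv (gcdn s j) %| j)%N.
  by rewrite -dvdn_gcd pdiv_dvd.
rewrite -leqNgt; apply: leq_trans (ps _ pg gs) _; exact: dvdn_leq.
Qed.

(** * Units and a form of Lagrange's theorem *)

Section Units.
Variable S : pzRingType.
Implicit Types (x y u : S) (A : set S).

Lemma units_of_one_sided_inverses x y z : y * x = 1 -> x * z = 1 -> units S x.
Proof.
move=> yx xz; exists z; split=> //.
by rewrite -[z]mul1r -yx -(mulrA y) xz mulr1.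
Qed.

Lemma units_sub_nilpotent n x : x ^+ n = 0 -> units S (1 - x).
Proof.
move=> xn0; exists (\sum_(i < n) x ^+ i).
have inv : (1 - x) * (\sum_(i < n) x ^+ i) = 1.
  by rewrite -opprB mulNr -subrX1 xn0 sub0r opprK.
split=> //; rewrite -[RHS]inv; apply/esym/commr_sum => i _.
by apply: commrX; apply/commr_sym/commrB; [exact: commr1|].
Qed.

(** An inverse of [x * y] yields a right inverse of [x], and one of [y * x] a left inverse. *)
Lemma units_mul_units x y :
  units S (x * y) -> units S (y * x) -> units S x.
Proof.
case=> a [xya _] [b [_ byx]].
apply: (@units_of_one_sided_inverses _ (b * y) (y * a)).
  by rewrite -mulrA.
by rewrite mulrA.
Qed.

(* All orbits of left multiplication by [u] on [A] have the same length, which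
   therefore divides the cardinal of [A]. *)
Lemma expr_set_card A u : finite_set A -> A `<=` units S -> units S u ->
  (forall x, A x -> A (u * x)) -> u ^+ set_card A = 1.
Proof.
move=> finA Aunits [v [uv vu]] AuA.
pose T : finType := fset_set A.
have memA (x : T) : A (fsval x).
  by have := fsvalP x; rewrite in_fset_set // inE.
have uT (x : T) : u * fsval x \in fset_set A.
  by rewrite in_fset_set // inE; apply: AuA.
pose f (x : T) : T := [` uT x]%fset.
have f_inj : injective f.
  move=> x y /(congr1 (fun z : T => v * fsval z)) /=.
  by rewrite !mulrA vu !mul1r => /val_inj.
have iter_f n (x : T) : fsval (iter n f x) = u ^+ n * fsval x.
  elim: n => [|n IHn]; first by rewrite expr0 mul1r.
  by rewrite iterS /= IHn exprS mulrA.
(* Going once around the orbit gives [u ^+ n * x = x], and the unit [x] cancels. *)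
have order_f (x : T) : u ^+ order f x = 1.
  have /(congr1 val) := iter_order f_inj x; rewrite /= iter_f => ux.
  have [y [xy _]] := Aunits _ (memA x).
  by rewrite -[LHS]mulr1 -xy mulrA ux.
have order_le (x y : T) : (order f x <= order f y)%N.
  rewrite leqNgt; apply/negP => yx.
  have fx : iter (order f y) f x = x.
    by apply: val_inj; rewrite /= iter_f order_f mul1r.
  have := findex_iter yx; rewrite fx findex0 => y0.
  by have := order_gt0 f y; rewrite -y0.
rewrite /set_card cardfE.
(* The common orbit length is read off at some element; if [A] is empty, the exponent is 0. *)
have [/= x _|T0] := pickP (@predT T); last first.
  by rewrite (eq_card T0) card0 expr0.
have /fcard_order_set <- // : T \subset order_set f (order f x).
  apply/fintype.subsetP => y _.
  by rewrite unfold_in /order_set /= eqn_leq !order_le.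
by rewrite mulnC exprM order_f expr1n.
Qed.

End Units.

Lemma residue_units (R : pzRingType) (I : ideal R) (x : R) :
  units R x -> units (quot_ring I) (residue I x).
Proof.
by case=> y [xy yx]; exists (residue I y); rewrite -!rmorphM xy yx rmorph1.
Qed.

Lemma residue_eq1 (R : pzRingType) (I : ideal R) (x : R) :
  residue I x = 1 <-> ideal_set I (x - 1).
Proof. by rewrite -(rmorph1 (residue I)); exact: residue_eq. Qed.

(** * Descent along the chain of ideals *)

Section Ideals.
Variables (R : pzRingType).
Implicit Types (I J : ideal R).

Lemma idealN I x : ideal_set I x -> ideal_set I (- x).
Proof. by move=> Ix; rewrite -sub0r; apply: idealB => //; exact: ideal0. Qed.

Lemma idealD I x y : ideal_set I x -> ideal_set I y -> ideal_set I (x + y).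
Proof.
by move=> Ix Iy; rewrite -[y]opprK; apply: idealB => //; exact: idealN.
Qed.

Lemma ideal_powX (I : set R) x n : I x -> ideal_pow I n (x ^+ n).
Proof.
move=> Ix; elim: n => [//|n IHn].
exists [:: (x, x ^+ n)]; split=> [p|]; last by rewrite big_seq1 exprS.
by rewrite inE => /eqP ->.
Qed.

Lemma nilpotent_boundX I J t x j :
  nilpotent_bound I J t -> ideal_set I x -> (t <= j)%N -> ideal_set J (x ^+ j).
Proof.
case=> _ ItJ Ix tj; rewrite -(subnK tj) exprD.
exact/idealMl/ItJ/ideal_powX.
Qed.

Lemma char_boundX I J t s y : nilpotent_bound I J t -> char_bound I J t s ->
  ideal_set I (y - 1) -> ideal_set J (y ^+ s - 1).
Proof.
move=> tIJ [_ sIJ ps]; set x := y - 1 => Ix.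
have -> : y = x + 1 by rewrite subrK.
rewrite exprDn_comm; last exact: commr1.
(* The last binomial term is 1 and cancels; in the others [x] has exponent [s - i > 0]. *)
rewrite big_ord_recr /= subnn expr0 mul1r expr1n binn mulr1n addrK.
apply: (big_ind (ideal_set J)) => [||i _]; [exact: ideal0|exact: idealD|].
rewrite expr1n mulr1.
have j_gt0 : (0 < s - i)%N by rewrite subn_gt0.
rewrite -bin_sub ?(ltnW (ltn_ord i)) //; set j := (s - i)%N in j_gt0 *.
have [tj|jt] := leqP t j.
  by rewrite -mulr_natr; apply: Defs.idealMr; exact: nilpotent_boundX tIJ Ix tj.
have /dvdnP[c ->] : (s %| 'C(s, j))%N.
  apply: dvdn_bin_of_coprime => //; apply: coprime_lt_prime_factors ps _.
  by rewrite j_gt0.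
rewrite mulnC mulrnA -mulr_natr; apply: Defs.idealMr; apply: sIJ.
exists (x ^+ j) => //; case: j j_gt0 {jt} => // j _.
by rewrite exprS; exact: Defs.idealMr.
Qed.

Lemma CNC_expr_prod k (N : nat -> ideal R) (s : nat -> nat) x : CNC k N ->
  (forall i, (1 <= i < k)%N -> characteristic_in (N i) (N i.+1) (s i)) ->
  ideal_set (N 1%N) (x - 1) -> x ^+ (\prod_(1 <= i < k) s i)%N = 1.
Proof.
move=> [k_gt0 Nk _ _] hs Nx.
(* After [j] steps the power lies in [1 + N j.+1]; at [j = k.-1] this ideal is zero. *)
have step j : (j < k)%N ->
    ideal_set (N j.+1) (x ^+ (\prod_(1 <= i < j.+1) s i)%N - 1).
  elim: j => [|j IHj] jk; first by rewrite big_geq // expr1.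
  rewrite big_nat_recr //= exprM.
  have [|t [[tN _] [sN _]]] := hs j.+1; first exact: jk.
  by apply: char_boundX tN sN _; apply: IHj; exact: ltnW.
have := step k.-1; rewrite prednK // Nk => /(_ (leqnn _)) /= /eqP.
by rewrite subr_eq0 => /eqP.
Qed.

(** Each power [t_i] moves an element from [N i] into [N i.+1], so the product of the [t_i] is a
    suitable exponent. *)
Lemma CNC_nil k (N : nat -> ideal R) x : CNC k N -> ideal_set (N 1%N) x ->
  exists n, x ^+ n = 0.
Proof.
move=> [k_gt0 Nk _ hN] Nx.
have step j : (j < k)%N -> exists n, ideal_set (N j.+1) (x ^+ n).
  elim: j => [|j IHj] jk; first by exists 1%N; rewrite expr1.
  have [n Nn] := IHj (ltnW jk).
  have [|t [tN _]] := hN j.+1; first exact: jk.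
  by exists (n * t)%N; rewrite exprM; exact: nilpotent_boundX tN Nn (leqnn t).
have := step k.-1; rewrite prednK // Nk => /(_ (leqnn _)) [n /= xn].
by exists n.
Qed.

Lemma set_card_translate (A : set R) x :
  finite_set A -> set_card [set x + y | y in A] = set_card A.
Proof.
move=> finA; rewrite /set_card fset_set_image // card_imfset //=.
exact: addrI.
Qed.

(** * Units modulo a nil ideal *)

Section NilIdeal.
Variable I : ideal R.
Hypothesis nilI : forall x, ideal_set I x -> exists n, x ^+ n = 0.

Lemma units_add1_nil x : ideal_set I x -> units R (1 + x).
Proof.
move=> /idealN /nilI[n xn0].
by rewrite -[x]opprK; exact: units_sub_nilpotent xn0.
Qed.

(** If [y] lifts the inverse of the residue, [x * y] and [y * x] lie in [1 + I], so both are
    units. *)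
Lemma units_lift_nil x : units (quot_ring I) (residue I x) -> units R x.
Proof.
case=> u []; have [y <-] := residue_surj u.
rewrite -!rmorphM => /residue_eq1 Ixy /residue_eq1 Iyx.
apply: (@units_mul_units _ x y).
  by rewrite -[x * y](subrKC 1); exact: units_add1_nil.
by rewrite -[y * x](subrKC 1); exact: units_add1_nil.
Qed.

Lemma finite_nil : finite_set (units R) -> finite_set I.
Proof.
move=> finU; apply: (sub_finite_set _ (finite_image (fun x => x - 1) finU)).
by move=> x Ix; exists (1 + x); [exact: units_add1_nil|rewrite addrC addKr].
Qed.

Lemma finite_units_quot :
  finite_set (units R) -> finite_set (units (quot_ring I)).
Proof.
move=> finU; apply: (sub_finite_set _ (finite_image (residue I) finU)).
move=> u; have [x <-] := residue_surj u => ux.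
by exists x => //; exact: units_lift_nil.
Qed.

Lemma expr_set_card_nil x :
  finite_set I -> ideal_set I (x - 1) -> x ^+ set_card I = 1.
Proof.
move=> finI Ix; rewrite -(set_card_translate 1 finI); apply: expr_set_card.
- exact: finite_image.
- by move=> _ [y Iy <-]; exact: units_add1_nil.
- by rewrite -[x](subrKC 1); exact: units_add1_nil.
(* The witness comes from [x * (1 + y) = 1 + (x - 1 + x * y)]. *)
- move=> _ [y Iy <-]; exists (x - 1 + x * y).
    by apply: idealD => //; exact: idealMl.
  by rewrite addrA subrKC mulrDr mulr1.
Qed.

End NilIdeal.
End Ideals.

Lemma units_expr_set_card (S : pzRingType) (u : S) :
  finite_set (units S) -> units S u -> u ^+ set_card (units S) = 1.
Proof.
move=> finU uU; apply: expr_set_card => // x [y [xy yx]].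
case: uU => v [uv vu]; exists (y * v); split.
  by rewrite -mulrA (mulrA x) xy mul1r.
by rewrite -mulrA (mulrA v) vu mul1r.
Qed.

Theorem theorem3p2 (R : pzRingType) (k : nat) (N : nat -> ideal R)
    (s : nat -> nat) (hN : CNC k N)
    (hs : forall i, (1 <= i < k)%N -> characteristic_in (N i) (N i.+1) (s i)) :
  (forall w : nat,
     (forall u : quot_ring (N 1%N), units (quot_ring (N 1%N)) u -> u ^+ w = 1) ->
     forall x : R, units R x -> x ^+ (w * \prod_(1 <= i < k) s i)%N = 1) /\
  (finite_set (units (quot_ring (N 1%N))) ->
     forall x : R, units R x ->
       x ^+ (set_card (units (quot_ring (N 1%N)))
             * \prod_(1 <= i < k) s i)%N = 1) /\
  (finite_set (units R) ->
     [/\ finite_set (units (quot_ring (N 1%N))), finite_set (N 1%N)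
       & forall x : R, units R x ->
           x ^+ (set_card (units (quot_ring (N 1%N))) * set_card (N 1%N))%N = 1]).
Proof.
have expN w x : (forall u, units (quot_ring (N 1%N)) u -> u ^+ w = 1) ->
    units R x -> ideal_set (N 1%N) (x ^+ w - 1).
  move=> hw xU; apply/residue_eq1; rewrite rmorphXn; apply: hw.
  exact: residue_units.
have nilN x : ideal_set (N 1%N) x -> exists n, x ^+ n = 0.
  exact: (CNC_nil hN).
have part1 w : (forall u, units (quot_ring (N 1%N)) u -> u ^+ w = 1) ->
    forall x, units R x -> x ^+ (w * \prod_(1 <= i < k) s i)%N = 1.
  move=> hw x xU.
  by rewrite exprM; apply: CNC_expr_prod hN hs _; exact: expN.
split=> //; split=> [finQ|finU].
  by apply: part1 => u; exact: units_expr_set_card.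
(* Finiteness makes each [set_card] a true cardinal, not the default 0. *)
have finQ := finite_units_quot nilN finU; have finN := finite_nil nilN finU.
(* The first factor of the exponent brings [x] into [1 + N 1], and the second is the order of that
   group. *)
split=> // x xU; rewrite exprM; apply: expr_set_card_nil => //.
apply: expN xU => u.
exact: units_expr_set_card.
Qed.
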